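(* A conditional relation $R$ is a conditional bisimulation up-to context if and only if it is a conditional bisimulation up-to context with representative steps.
   Context: Composition of $f\colon A\to B$, $g\colon B\to C$ is written $f;g$. Fix a category $\mathbf C$ with distinguished object $0$ and a representative class $\kappa$ of commuting squares: for every commuting square $\alpha_1;\delta_1=\alpha_2;\delta_2$ there are $(\alpha_1,\alpha_2,\beta_1,\beta_2)\in\kappa$ (a commuting square) and $\gamma$ with $\delta_1=\beta_1;\gamma$, $\delta_2=\beta_2;\gamma$; $\kappa(\alpha_1,\alpha_2)$ is the set of $(\beta_1,\beta_2)$ with $(\alpha_1,\alpha_2,\beta_1,\beta_2)\in\kappa$. Conditions over $A$ are defined inductively as $(A,\mathcal Q,S)$, $\mathcal Q\in\{\forall,\exists\}$, $S$ a finite set of pairs $(h,\mathcal A')$ with $h\colon A\to A'$, $\mathcal A'$ a condition over $A'$. For $a\colon A\to B$: $a\models(A,\forall,S)$ iff for all $(h,\mathcal A')\in S$ and all $g$ with $a=h;g$, $g\models\mathcal A'$; $a\models(A,\exists,S)$ iff some $(h,\mathcal A')\in S$ and $g$ satisfy $a=h;g$, $g\models\mathcal A'$. $\mathcal A\models\mathcal B$: every arrow satisfying $\mathcal A$ satisfies $\mathcal B$. Boolean connectives have the standard semantics. Shift along $c\colon A\to B$: $(A,\mathcal Q,S)_{\downarrow c}=(B,\mathcal Q,\{(\beta,\mathcal A'_{\downarrow\alpha})\mid(h,\mathcal A')\in S,(\alpha,\beta)\in\kappa(h,c)\})$; it satisfies $c;d\models\mathcal A\iff d\models\mathcal A_{\downarrow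 c}$. A conditional reactive system is a set $\mathcal S$ of rules $(\ell,r,\mathcal R)$, $\ell,r\colon0\to I$, $\mathcal R$ a condition over $I$. Context step $a\xrightarrow[C]{f,\ \mathcal A}a'$ ($a\colon0\to J$, $f\colon J\to K$, $a'\colon0\to K$, $\mathcal A$ over $K$): there are a rule $(\ell,r,\mathcal R)\in\mathcal S$ and $c\colon I\to K$ with $a;f=\ell;c$, $a'=r;c$, $\mathcal A\models\mathcal R_{\downarrow c}$. Representative step $a\xrightarrow[R]{f,\ \mathcal A}a'$: a context step with additionally $(f,c)\in\kappa(a,\ell)$ and $\mathcal A=\mathcal R_{\downarrow c}$. A conditional relation is a set of triples $(a,b,\mathcal C)$, $a,b\colon0\to J$, $\mathcal C$ a condition over $J$. $\mathcal D\models\bigvee_{i\in I}\mathcal E_i$ (possibly infinite $I$): every arrow satisfying $\mathcal D$ satisfies some $\mathcal E_i$. A conditional bisimulation up-to context is a conditional relation $R$ such that for each $(a,b,\mathcal C)\in R$ and each context step $a\xrightarrow[C]{f,\ \mathcal A}a'$ there are an index set $I$, context steps $b\xrightarrow[C]{f,\ \mathcal B_i}b'_i$, and for each $i\in I$ a triple $(a''_i,b''_i,\mathcal C''_i)\in R$ and an arrow $j_i$ with $a'=a''_i;j_i$, $b'_i=b''_i;j_i$, such that $\mathcal A\land\mathcal C_{\downarrow f}\models\bigvee_{i\in I}((\mathcal C''_i)_{\downarrow j_i}\land\mathcal B_i)$; and symmetrically for context steps of $b$ answered by context steps of $a$. A conditional bisimulation up-to context with representative steps is defined identically except that only representative steps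 $a\xrightarrow[R]{f,\ \mathcal A}a'$ (resp. representative steps of $b$) must be answered (still by context steps). *)

(* Defs.v *)
From Stdlib Require Import List ClassicalEpsilon.
Import ListNotations.

Set Implicit Arguments.
Unset Strict Implicit.
Unset Printing Implicit Defensive.

Record category : Type := Category {
  Obj :> Type;
  Hom : Obj -> Obj -> Type;
  idm : forall A : Obj, Hom A A;
  comp : forall A B C : Obj, Hom A B -> Hom B C -> Hom A C;
  compA : forall (A B C D : Obj) (f : Hom A B) (g : Hom B C) (h : Hom C D),
    comp f (comp g h) = comp (comp f g) h;
  comp_idl : forall (A B : Obj) (f : Hom A B), comp (idm A) f = f;
  comp_idr : forall (A B : Obj) (f : Hom A B), comp f (idm B) = f
}.

Arguments Hom {_} _ _.
Arguments idm {_} _.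
Arguments comp {_ A B C} _ _.

(* Diagrammatic order: f first, then g. *)
Notation "f ;; g" := (comp f g) (at level 50, left associativity).

Definition cospan (C : category) (B1 B2 : C) : Type :=
  {D : C & (Hom B1 D * Hom B2 D)%type}.

(* Conditions are finitely branching, so the shift operation below is total
   only if every kappa(alpha1, alpha2) is finite: this is [kappa_fin]. *)
Record representative_class (C : category) : Type := RepresentativeClass {
  kappa : forall A B1 B2 D : C,
    Hom A B1 -> Hom A B2 -> Hom B1 D -> Hom B2 D -> Prop;
  kappa_comm : forall (A B1 B2 D : C) (a1 : Hom A B1) (a2 : Hom A B2)
      (b1 : Hom B1 D) (b2 : Hom B2 D),
    kappa a1 a2 b1 b2 -> a1 ;; b1 = a2 ;; b2;
  kappa_repr : forall (A B1 B2 E : C) (a1 : Hom A B1) (a2 : Hom A B2)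
      (d1 : Hom B1 E) (d2 : Hom B2 E),
    a1 ;; d1 = a2 ;; d2 ->
    exists (D : C) (b1 : Hom B1 D) (b2 : Hom B2 D) (g : Hom D E),
      kappa a1 a2 b1 b2 /\ d1 = b1 ;; g /\ d2 = b2 ;; g;
  kappa_fin : forall (A B1 B2 : C) (a1 : Hom A B1) (a2 : Hom A B2),
    exists s : list (cospan B1 B2), forall (D : C) (b1 : Hom B1 D) (b2 : Hom B2 D),
      In (existT _ D (b1, b2)) s <-> kappa a1 a2 b1 b2
}.

Arguments kappa {C} _ {A B1 B2 D} _ _ _ _.

Definition kappa_enum (C : category) (K : representative_class C) (A B1 B2 : C)
    (a1 : Hom A B1) (a2 : Hom A B2) : list (cospan B1 B2) :=
  proj1_sig (constructive_indefinite_description _ (kappa_fin K a1 a2)).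

Lemma kappa_enumP (C : category) (K : representative_class C) (A B1 B2 D : C)
    (a1 : Hom A B1) (a2 : Hom A B2) (b1 : Hom B1 D) (b2 : Hom B2 D) :
  In (existT _ D (b1, b2)) (kappa_enum K a1 a2) <-> kappa K a1 a2 b1 b2.
Proof.
exact (proj2_sig (constructive_indefinite_description _ (kappa_fin K a1 a2)) D b1 b2).
Qed.

Inductive quantifier : Type := Forall_q | Exists_q.

(* The finite set of branches is represented by a list. *)
Inductive condition (C : category) (A : C) : Type :=
  Cond : quantifier -> list {A' : C & (Hom A A' * condition A')%type} -> condition A.

Arguments Cond {C A} _ _.

Definition branch (C : category) (A : C) : Type :=
  {A' : C & (Hom A A' * condition A')%type}.

(* [fold_right] instead of [Forall]/[Exists], for the guard condition;
   see [sat_forall] and [sat_exists]. *)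
Fixpoint sat (C : category) (A : C) (P : condition A) (B : C) (a : Hom A B)
    {struct P} : Prop :=
  match P with
  | Cond Forall_q bs =>
      fold_right (fun (br : branch A) (acc : Prop) =>
        let (A', p) := br in let (h, P') := p in
        (forall g : Hom A' B, a = h ;; g -> sat P' g) /\ acc) True bs
  | Cond Exists_q bs =>
      fold_right (fun (br : branch A) (acc : Prop) =>
        let (A', p) := br in let (h, P') := p in
        (exists g : Hom A' B, a = h ;; g /\ sat P' g) \/ acc) False bs
  end.

Lemma sat_forall (C : category) (A B : C)
    (bs : list (branch A)) (a : Hom A B) :
  sat (Cond Forall_q bs) a <->
  (forall (A' : C) (h : Hom A A') (P' : condition A'), In (existT _ A' (h, P')) bs ->
    forall g : Hom A' B, a = h ;; g -> sat P' g).
Proof.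
induction bs as [|[A0 [h0 P0]] bs IH]; [simpl; tauto|].
change (sat (Cond Forall_q (existT _ A0 (h0, P0) :: bs)) a)
  with ((forall g : Hom A0 B, a = h0 ;; g -> sat P0 g) /\ sat (Cond Forall_q bs) a).
rewrite IH; split.
- intros [H0 H] A' h P' [E|Hin]; [|exact (H _ _ _ Hin)].
  change (match existT (fun A' : C => (Hom A A' * condition A')%type) A' (h, P') with
          | existT _ A1 (h1, P1) => forall g : Hom A1 B, a = h1 ;; g -> sat P1 g end).
  rewrite <- E; exact H0.
- intros H; split; intros.
  + eapply H; [left; reflexivity|eassumption].
  + eapply H; [right; eassumption|eassumption].
Qed.

Lemma sat_exists (C : category) (A B : C)
    (bs : list (branch A)) (a : Hom A B) :
  sat (Cond Exists_q bs) a <->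
  (exists (A' : C) (h : Hom A A') (P' : condition A'), In (existT _ A' (h, P')) bs /\
    exists g : Hom A' B, a = h ;; g /\ sat P' g).
Proof.
induction bs as [|[A0 [h0 P0]] bs IH].
{ simpl; split; [tauto|intros (? & ? & ? & [] & _)]. }
change (sat (Cond Exists_q (existT _ A0 (h0, P0) :: bs)) a)
  with ((exists g : Hom A0 B, a = h0 ;; g /\ sat P0 g) \/ sat (Cond Exists_q bs) a).
rewrite IH; split.
- intros [H0|(A' & h & P' & Hin & H)].
  + exists A0, h0, P0; split; [left; reflexivity|exact H0].
  + exists A', h, P'; split; [right; exact Hin|exact H].
- intros (A' & h & P' & [E|Hin] & H); [left|right; exists A', h, P'; auto].
  change (match existT (fun A' : C => (Hom A A' * condition A')%type) A0 (h0, P0) with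
          | existT _ A1 (h1, P1) => exists g : Hom A1 B, a = h1 ;; g /\ sat P1 g end).
  rewrite E; exact H.
Qed.

Definition entails (C : category) (A : C) (P Q : condition A) : Prop :=
  forall (B : C) (a : Hom A B), sat P a -> sat Q a.

Fixpoint shift (C : category) (K : representative_class C) (A : C)
    (P : condition A) (B : C) (c : Hom A B) {struct P} : condition B :=
  match P with
  | Cond q bs =>
      Cond q (flat_map (fun br : branch A =>
        let (A', p) := br in let (h, P') := p in
        map (fun sq : cospan A' B =>
          let (D, ab) := sq in let (alpha, beta) := ab in
          existT (fun D => (Hom B D * condition D)%type) D (beta, shift K P' alpha))
          (kappa_enum K h c)) bs)
  end.

Record rule (C : category) (zero : C) : Type := Rule {
  iface : C;
  lhs : Hom zero iface;
  rhs : Hom zero iface;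
  appcond : condition iface
}.

Definition reactive_system (C : category) (zero : C) : Type := rule zero -> Prop.

Definition labelled_steps (C : category) (zero : C) : Type :=
  forall J K' : C, Hom zero J -> Hom J K' -> condition K' -> Hom zero K' -> Prop.

Definition context_step (C : category) (zero : C) (K : representative_class C)
    (Sys : reactive_system zero) : labelled_steps zero :=
  fun J K' a f P a' =>
    exists (rl : rule zero) (c : Hom (iface rl) K'),
      Sys rl /\ a ;; f = lhs rl ;; c /\ a' = rhs rl ;; c /\
      entails P (shift K (appcond rl) c).

Definition representative_step (C : category) (zero : C) (K : representative_class C)
    (Sys : reactive_system zero) : labelled_steps zero :=
  fun J K' a f P a' =>
    exists (rl : rule zero) (c : Hom (iface rl) K'),
      (Sys rl /\ a ;; f = lhs rl ;; c /\ a' = rhs rl ;; c /\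
       entails P (shift K (appcond rl) c)) /\
      kappa K a (lhs rl) f c /\ P = shift K (appcond rl) c.

Definition conditional_relation (C : category) (zero : C) : Type :=
  forall J : C, Hom zero J -> Hom zero J -> condition J -> Prop.

Definition converse (C : category) (zero : C) (R : conditional_relation zero) :
    conditional_relation zero :=
  fun J a b P => R J b a P.

(* The last clause is the entailment of a possibly infinite disjunction, with the
   Boolean connectives (which are not constructors of [condition]) read
   semantically on an arbitrary arrow d out of K'. *)
Definition answers_up_to_context (C : category) (zero : C)
    (K : representative_class C) (Sys : reactive_system zero)
    (steps : labelled_steps zero) (R : conditional_relation zero) : Prop :=
  forall (J : C) (a b : Hom zero J) (P : condition J), R J a b P ->
  forall (K' : C) (f : Hom J K') (Q : condition K') (a' : Hom zero K'),
  steps J K' a f Q a' ->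
  exists (I : Type) (B : I -> condition K') (b' : I -> Hom zero K')
    (J'' : I -> C) (a'' b'' : forall i : I, Hom zero (J'' i))
    (P'' : forall i : I, condition (J'' i)) (j : forall i : I, Hom (J'' i) K'),
    (forall i : I,
      context_step K Sys b f (B i) (b' i) /\
      R (J'' i) (a'' i) (b'' i) (P'' i) /\
      a' = a'' i ;; j i /\
      b' i = b'' i ;; j i) /\
    (forall (L : C) (d : Hom K' L),
      sat Q d /\ sat (shift K P f) d ->
      exists i : I, sat (shift K (P'' i) (j i)) d /\ sat (B i) d).

Definition cond_bisim_up_to_context (C : category) (zero : C)
    (K : representative_class C) (Sys : reactive_system zero)
    (R : conditional_relation zero) : Prop :=
  answers_up_to_context K Sys (context_step K Sys) R /\
  answers_up_to_context K Sys (context_step K Sys) (converse R).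

Definition cond_bisim_up_to_context_repr (C : category) (zero : C)
    (K : representative_class C) (Sys : reactive_system zero)
    (R : conditional_relation zero) : Prop :=
  answers_up_to_context K Sys (representative_step K Sys) R /\
  answers_up_to_context K Sys (representative_step K Sys) (converse R).

(* Main.v *)
From Stdlib Require Import List.
Require Import Defs.

Set Implicit Arguments.
Unset Strict Implicit.

(** Every context step of [a] with label [f] factors through a representative
    step with label [f0], where [f = f0 ;; g].  The answers of [b] to the
    representative step, extended by [g] (with their conditions shifted along
    [g]), are answers to the original step: shifting turns satisfaction by [d]
    into satisfaction by [g ;; d], so the entailment for the original step at
    [d] is the one for the representative step at [g ;; d]. *)

(** The recursive occurrences of [condition] sit inside a list of dependent pairs; this principle
    supplies an induction hypothesis for every branch of that list. *)
Lemma condition_nested_ind (C : category)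
    (Pr : forall A : C, condition A -> Prop)
    (step : forall (A : C) (q : quantifier) (bs : list (branch A)),
      (forall (A' : C) (h : Hom A A') (P' : condition A'),
        In (existT _ A' (h, P')) bs -> Pr A' P') ->
      Pr A (Cond q bs)) :
  forall (A : C) (P : condition A), Pr A P.
Proof.
fix IH 2; intros A [q bs]; apply step.
(* The inner induction on [bs] calls [IH] only on conditions stored in the list, so the fixpoint
   remains structurally decreasing. *)
assert (H : forall br : branch A, In br bs -> Pr (projT1 br) (snd (projT2 br))).
{ induction bs as [|[A0 [h0 P0]] bs IHbs]; [intros _ []|].
  intros br [<-|Hin]; [exact (IH A0 P0)|exact (IHbs br Hin)]. }
intros A' h P' Hin; exact (H _ Hin).
Qed.

(** A copy of the branch list in the body of [shift], so that unfolding one level of [shift] is a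
    conversion. *)
Definition shift_branches (C : category) (K : representative_class C) (A B : C)
    (c : Hom A B) (bs : list (branch A)) : list (branch B) :=
  flat_map (fun br : branch A =>
    let (A', p) := br in let (h, P') := p in
    map (fun sq : cospan A' B =>
      let (D, ab) := sq in let (alpha, beta) := ab in
      existT (fun D => (Hom B D * condition D)%type) D (beta, shift K P' alpha))
      (kappa_enum K h c)) bs.

Lemma shift_Cond (C : category) (K : representative_class C) (A B : C)
    (c : Hom A B) (q : quantifier) (bs : list (branch A)) :
  shift K (Cond q bs) c = Cond q (shift_branches K c bs).
Proof. reflexivity. Qed.

Lemma in_shift_branches (C : category) (K : representative_class C) (A B : C)
    (c : Hom A B) (bs : list (branch A)) (br : branch B) :
  In br (shift_branches K c bs) <->
  exists (A' D : C) (h : Hom A A') (P' : condition A')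
      (alpha : Hom A' D) (beta : Hom B D),
    In (existT _ A' (h, P')) bs /\ kappa K h c alpha beta /\
    existT _ D (beta, shift K P' alpha) = br.
Proof.
unfold shift_branches; rewrite in_flat_map; split.
- intros [[A' [h P']] [Hin Hmap]].
  apply in_map_iff in Hmap as [[D [alpha beta]] [E Hk]].
  apply kappa_enumP in Hk.
  exists A', D, h, P', alpha, beta; auto.
- intros (A' & D & h & P' & alpha & beta & Hin & Hk & E).
  exists (existT _ A' (h, P')); split; [exact Hin|].
  apply in_map_iff; exists (existT _ D (alpha, beta)); split; [exact E|].
  now apply kappa_enumP.
Qed.

(* Quantifying over whole branches avoids inverting equalities of dependent
   pairs. *)
Lemma sat_forall_branch (C : category) (A B : C) (bs : list (branch A))
    (a : Hom A B) :
  sat (Cond Forall_q bs) a <->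
  (forall br : branch A, In br bs ->
    forall g : Hom (projT1 br) B,
      a = fst (projT2 br) ;; g -> sat (snd (projT2 br)) g).
Proof.
rewrite sat_forall; split.
- intros H [A' [h P']]; exact (H A' h P').
- intros H A' h P'; exact (H (existT _ A' (h, P'))).
Qed.

Lemma sat_exists_branch (C : category) (A B : C) (bs : list (branch A))
    (a : Hom A B) :
  sat (Cond Exists_q bs) a <->
  (exists br : branch A, In br bs /\
    exists g : Hom (projT1 br) B,
      a = fst (projT2 br) ;; g /\ sat (snd (projT2 br)) g).
Proof.
rewrite sat_exists; split.
- intros (A' & h & P' & H); exists (existT _ A' (h, P')); exact H.
- intros ([A' [h P']] & H); exists A', h, P'; exact H.
Qed.

(** A factorisation [c ;; d = h ;; g] is a commuting square over [h] and [c], so it factors through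
    a square of [kappa], that is, through a branch of the shifted condition. Conversely, squares of
    [kappa] commute, so a factorisation of [d] through a shifted branch yields one of [c ;; d]
    through [h]. *)
Lemma sat_shift (C : category) (K : representative_class C) (A : C)
    (P : condition A) :
  forall (B E : C) (c : Hom A B) (d : Hom B E),
    sat (shift K P c) d <-> sat P (c ;; d).
Proof.
induction P as [A [] bs IH] using condition_nested_ind;
  intros B E c d; rewrite shift_Cond.
- rewrite sat_forall_branch, sat_forall; split.
  + intros H A' h P' Hin g Hg.
    (* Here [g] becomes [alpha ;; g'] while [d = beta ;; g']; the induction hypothesis is then used
       with shift along [alpha]. *)
    destruct (kappa_repr K (eq_sym Hg)) as (D & alpha & beta & g' & Hk & -> & Hd).
    apply (IH A' h P' Hin).
    refine (H (existT _ D (beta, shift K P' alpha)) _ g' Hd).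
    apply in_shift_branches; exists A', D, h, P', alpha, beta; auto.
  + intros H br Hbr.
    apply in_shift_branches in Hbr
      as (A' & D & h & P' & alpha & beta & Hin & Hk & <-).
    simpl; intros g ->.
    apply (IH A' h P' Hin), (H A' h P' Hin).
    now rewrite !compA, (kappa_comm Hk).
- rewrite sat_exists_branch, sat_exists; split.
  + intros (br & Hbr & H).
    apply in_shift_branches in Hbr
      as (A' & D & h & P' & alpha & beta & Hin & Hk & <-).
    simpl in H; destruct H as (g & -> & Hg).
    exists A', h, P'; split; [exact Hin|].
    exists (alpha ;; g); split.
    * now rewrite !compA, (kappa_comm Hk).
    * now apply (IH A' h P' Hin).
  + intros (A' & h & P' & Hin & g & Hg & Hs).
    destruct (kappa_repr K (eq_sym Hg)) as (D & alpha & beta & g' & Hk & -> & Hd).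
    exists (existT _ D (beta, shift K P' alpha)); split.
    * apply in_shift_branches; exists A', D, h, P', alpha, beta; auto.
    * exists g'; split; [exact Hd|].
      now apply (IH A' h P' Hin).
Qed.

Lemma representative_step_context (C : category) (zero : C)
    (K : representative_class C) (Sys : reactive_system zero) (J K' : C)
    (a : Hom zero J) (f : Hom J K') (Q : condition K') (a' : Hom zero K') :
  representative_step K Sys a f Q a' -> context_step K Sys a f Q a'.
Proof. intros (rl & c & H & _); exists rl, c; exact H. Qed.

(** Representativity splits the square of the step into a [kappa] square [(f0, c0)] followed by [g].
    Shifting the rule condition along [c0] and then [g] is equivalent to shifting it along
    [c0 ;; g], whence the entailment. *)
Lemma context_step_factor (C : category) (zero : C)
    (K : representative_class C) (Sys : reactive_system zero) (J K' : C)
    (a : Hom zero J) (f : Hom J K') (Q : condition K') (a' : Hom zero K') :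
  context_step K Sys a f Q a' ->
  exists (D : C) (f0 : Hom J D) (Q0 : condition D) (a0 : Hom zero D)
      (g : Hom D K'),
    representative_step K Sys a f0 Q0 a0 /\
    f = f0 ;; g /\ a' = a0 ;; g /\ entails Q (shift K Q0 g).
Proof.
intros (rl & c & HS & Hsq & -> & HQ).
destruct (kappa_repr K Hsq) as (D & f0 & c0 & g & Hk & -> & ->).
exists D, f0, (shift K (appcond rl) c0), (rhs rl ;; c0), g.
split; [|split; [reflexivity|split; [apply compA|]]].
- exists rl, c0; repeat split; auto.
  + exact (kappa_comm Hk).
  + intros L d Hd; exact Hd.
- intros L d Hd.
  apply HQ in Hd; rewrite sat_shift in Hd.
  now rewrite !sat_shift, compA.
Qed.

(** The same rule applies in the larger context [c ;; g]. *)
Lemma context_step_extend (C : category) (zero : C)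
    (K : representative_class C) (Sys : reactive_system zero) (J D K' : C)
    (b : Hom zero J) (f : Hom J D) (Q : condition D) (b' : Hom zero D)
    (g : Hom D K') :
  context_step K Sys b f Q b' ->
  context_step K Sys b (f ;; g) (shift K Q g) (b' ;; g).
Proof.
intros (rl & c & HS & Hsq & -> & HQ).
exists rl, (c ;; g); repeat split; auto.
- now rewrite !compA, Hsq.
- now rewrite compA.
- intros L d Hd.
  rewrite sat_shift in Hd; apply HQ in Hd; rewrite sat_shift in Hd.
  now rewrite sat_shift, <- compA.
Qed.

(** Stated for an arbitrary [R], so that it covers both [R] and [converse R]. *)
Lemma answers_context_iff_representative (C : category) (zero : C)
    (K : representative_class C) (Sys : reactive_system zero)
    (R : conditional_relation zero) :
  answers_up_to_context K Sys (context_step K Sys) R <->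
  answers_up_to_context K Sys (representative_step K Sys) R.
Proof.
split; intros H J a b P HR K' f Q a' Hstep.
- exact (H J a b P HR K' f Q a' (representative_step_context Hstep)).
- destruct (context_step_factor Hstep)
    as (D & f0 & Q0 & a0 & g & Hrep & -> & -> & HQ).
  destruct (H J a b P HR D f0 Q0 a0 Hrep)
    as (I & B & b' & J'' & a'' & b'' & P'' & j & Hans & Hent).
  (* The index set and the triples of [R] are kept; only the conditions, the targets and the
     contexts [j i] are carried along [g]. *)
  exists I, (fun i => shift K (B i) g), (fun i => b' i ;; g), J'', a'', b'', P'',
    (fun i => j i ;; g).
  split.
  + intros i; destruct (Hans i) as (Hb & Hi & Ea & Eb).
    split; [exact (context_step_extend g Hb)|split; [exact Hi|]].
    now rewrite Ea, Eb, !compA.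
  + intros L d [HdQ HdP].
    apply HQ in HdQ; rewrite sat_shift in HdQ.
    (* Reassociating moves [g] from the label to the arrow: [d] for the shift along [f0 ;; g]
       becomes [g ;; d] for the shift along [f0]. *)
    rewrite sat_shift, <- compA, <- (sat_shift K) in HdP.
    destruct (Hent L (g ;; d) (conj HdQ HdP)) as (i & Hi & HBi).
    exists i; rewrite !sat_shift; split; [|exact HBi].
    now rewrite sat_shift, compA in Hi.
Qed.

Theorem theorem5p16 (C : category) (zero : C) (K : representative_class C)
    (Sys : reactive_system zero) (R : conditional_relation zero) :
  cond_bisim_up_to_context K Sys R <-> cond_bisim_up_to_context_repr K Sys R.
Proof.
unfold cond_bisim_up_to_context, cond_bisim_up_to_context_repr.
now rewrite !answers_context_iff_representative.
Qed.
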